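(* Let $E$ be a subspace of a real or complex Banach lattice $X$, and let $\gamma\in(0,1]$. If $E$ does $\gamma$-Hölder stable phase retrieval in $X$ with constant $C>0$, then $E$ does stable phase retrieval in $X$ with constant $\sqrt2\,(\sqrt8\,C)^{1/\gamma}$.
   Context: ''Subspace'' means linear subspace over the scalar field. A complex Banach lattice is the complexification $X_{\mathbb C}=X\oplus iX$ of a real Banach lattice $X$, with modulus $|x+iy|=\sup_{\theta\in[0,2\pi]}\{x\cos\theta+y\sin\theta\}\in X_+$ and norm $\|x+iy\|=\big\||x+iy|\big\|_X$. A subspace $E$ of a real or complex Banach lattice $X$ does $\gamma$-Hölder stable phase retrieval with constant $C$ if for all $f,g\in E$ $$\inf_{|\lambda|=1}\|f-\lambda g\|\leq C\,\big\||f|-|g|\big\|^{\gamma}\big(\|f\|+\|g\|\big)^{1-\gamma}.$$ $E$ does stable phase retrieval with constant $C'$ if $\inf_{|\lambda|=1}\|f-\lambda g\|\leq C'\big\||f|-|g|\big\|$ for all $f,g\in E$. The infima are over scalars $\lambda$ with $|\lambda|=1$. *)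

(* Defs.v *)
From HB Require Import structures.
From mathcomp Require Import all_boot all_order all_algebra.
From mathcomp Require Import complex.
From mathcomp Require Import all_classical all_reals all_analysis.

Set Implicit Arguments.
Unset Strict Implicit.
Unset Printing Implicit Defensive.

Import Order.TTheory GRing.Theory Num.Theory.
Import numFieldNormedType.Exports.

Local Open Scope classical_set_scope.
Local Open Scope ring_scope.

(* The order is a field of the mixin, and the library's lattice structure is an
   instance on every Banach lattice, because Hierarchy Builder rejects a direct
   join of CompleteNormedModule with Order.Lattice. The norm is R-valued, and
   the hypothesis of ler_normv is `|x| <= |y|' for the lattice modulus. *)
HB.mixin Record isBanachLattice (R : realType) X
    & CompleteNormedModule R X := {
  lev : rel X ;
  joinv : X -> X -> X ;
  meetv : X -> X -> X ;
  lev_refl : reflexive lev ;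
  lev_anti : antisymmetric lev ;
  lev_trans : transitive lev ;
  levUx : forall x y z : X, lev (joinv x y) z = lev x z && lev y z ;
  levxI : forall z x y : X, lev z (meetv x y) = lev z x && lev z y ;
  lev_wD2r : forall z x y : X, lev x y -> lev (x + z) (y + z) ;
  scalev_ge0 : forall (a : R) (x : X), 0 <= a -> lev 0 x -> lev 0 (a *: x) ;
  ler_normv : forall x y : X,
    lev (joinv x (- x)) (joinv y (- y)) -> `|x| <= `|y| }.

#[short(type="banachLatticeType")]
HB.structure Definition BanachLattice (R : realType) :=
  { X of CompleteNormedModule R X & isBanachLattice R X }.

HB.instance Definition _ (R : realType) (X : banachLatticeType R) :=
  Order.Le_isPOrder.Build ring_display X lev_refl lev_anti lev_trans.
HB.instance Definition _ (R : realType) (X : banachLatticeType R) :=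
  Order.POrder_isMeetSemilattice.Build ring_display X levxI.
HB.instance Definition _ (R : realType) (X : banachLatticeType R) :=
  Order.POrder_isJoinSemilattice.Build ring_display X levUx.

Definition modulus {R : realType} {X : banachLatticeType R} (x : X) : X :=
  (x `|` - x)%O.

(* (x, y) stands for x + iy. The alias keeps the R[i]-module structure apart
   from the product structures of X * X; in particular the norm of the
   complexification is cnorm below, not the library's max norm on pairs. *)
Definition complexification (R : realType)
  (X : banachLatticeType R) : Type := (X * X)%type.

Section Complexification.
Context {R : realType} {X : banachLatticeType R}.
Local Notation XC := (complexification X).

HB.instance Definition _ := GRing.Zmodule.copy XC (X * X)%type.

Definition cscale (c : R[i]) (z : XC) : XC :=
  (complex.Re c *: z.1 - complex.Im c *: z.2,
   complex.Re c *: z.2 + complex.Im c *: z.1).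

Lemma cscaleA a b z : cscale a (cscale b z) = cscale (a * b) z.
Proof.
case: a b z => [a a'] [b b'] [x y]; rewrite /cscale /=; congr pair.
- rewrite scalerBr scalerDr !scalerA scalerBl scalerDl !opprD.
  by rewrite [X in _ + X]addrC addrACA.
- rewrite scalerBr scalerDr !scalerA scalerBl scalerDl.
  by rewrite [X in _ + X]addrC addrACA.
Qed.

Lemma cscale1 : left_id 1 cscale.
Proof. by case=> x y; rewrite /cscale /= !scale1r !scale0r subr0 addr0. Qed.

Lemma cscaleDr : right_distributive cscale +%R.
Proof.
by move=> c [x y] [z t]; rewrite /cscale /=; congr pair;
  rewrite /= !scalerDr ?opprD addrACA.
Qed.

Lemma cscaleDl z : {morph cscale^~ z : a b / a + b}.
Proof.
case: z => x y [a a'] [b b']; rewrite /cscale /=; congr pair;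
  by rewrite /= !scalerDl ?opprD addrACA.
Qed.

HB.instance Definition _ :=
  GRing.Zmodule_isLmodule.Build R[i] XC cscaleA cscale1 cscaleDr cscaleDl.

(* The supremum exists in every Banach lattice by norm completeness, so the
   default value 0 is never used. *)
Definition cmodulus (z : XC) : X :=
  supremum 0 [set cos t *: z.1 + sin t *: z.2 | t in `[0, 2 * pi]].

Definition cnorm (z : XC) : R := `|cmodulus z|.
End Complexification.

(* V is the ambient space over its scalar field K, with its norm nrm and its
   modulus md : V -> X: either V = X over R, with Num.norm and modulus, or
   V = complexification X over R[i], with cnorm and cmodulus.
   Conventions: 0 `^ 0 = 1 and 0 `^ a = 0 for a != 0. *)
Section StablePhaseRetrieval.
Context {R : realType} {X : banachLatticeType R}.
Context {K : numFieldType} {V : lmodType K} (nrm : V -> R) (md : V -> X).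

Definition phase_dist (f g : V) : R :=
  inf [set nrm (f - lam *: g) | lam in [set lam : K | `|lam| = 1]].

Definition holder_SPR (E : {pred V}) (gam C : R) :=
  {in E &, forall f g, phase_dist f g <=
     C * (`|md f - md g| `^ gam) * ((nrm f + nrm g) `^ (1 - gam))}.

Definition SPR (E : {pred V}) (C : R) :=
  {in E &, forall f g, phase_dist f g <= C * `|md f - md g|}.
End StablePhaseRetrieval.

(* Main.v *)
Require Import Defs.
From HB Require Import structures.
From mathcomp Require Import all_boot all_order all_algebra.
From mathcomp Require Import complex.
From mathcomp Require Import all_classical all_reals all_analysis.
From mathcomp Require Import ring lra.
Import Order.TTheory GRing.Theory Num.Theory.
Import numFieldNormedType.Exports Normc.
Set Implicit Arguments.
Unset Strict Implicit.
Unset Printing Implicit Defensive.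
Local Open Scope classical_set_scope.
Local Open Scope ring_scope.
Local Open Scope complex_scope.

(** Let f, g be in E with d = dist(f, g) = inf over unimodular l of
    ||f - l g||. The Hoelder inequality cannot be used on (f, g) itself,
    because ||f|| + ||g|| may be much larger than d. It is used on a pair
    (f', g') in the span of f and g whose distance is at least nearly
    1 / sqrt 2 and whose norms add up to at most 2, while | |f'| - |g'| | is at
    most sqrt 2 / d times | |f| - |g| |. For such a pair the factor
    (||f'|| + ||g'||)^(1 - gam) is bounded by 2, so that the inequality becomes
    1 <= sqrt 8 C (sqrt 2 e / d)^gam with e the norm of |f| - |g|; solving for
    d gives the constant ([holder_SPR_rescaled]).

    Real scalars: d is the smaller of ||f + g|| and ||f - g||. Normalising
    f + g and f - g and taking half the sum and half the difference of the two
    unit vectors gives f' and g' ([real_rescaled_pair]).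

    Complex scalars: consider the real-linear map M z = z f - z^* g from the
    plane to the complexification. Unimodular z give all the f - l g up to
    phase, so that d is the infimum of ||M z|| on the unit circle and
    ||M z|| >= d |z|. Two vectors z1, z2 with ||M z1||, ||M z2|| <= 1 that
    nearly maximise the area |det(z1, z2)| form almost an Auerbach basis for
    z |-> ||M z|| ([near_auerbach]). The pair (f', g') is the one whose map M'
    is M composed with T : x + iy |-> x z1 + y z2 ([complex_rescaled_pair]).
    The Auerbach property bounds ||M' w|| below by |w| / sqrt 2 up to eta, and
    |z1|, |z2| <= 1/d bounds the operator norm of T by sqrt 2 / d.

    It remains to compare | |f'| - |g'| | with | |f| - |g| |. For functions,
    | |f| - |g| | is pointwise the minimum over unimodular l of |f - l g|, that
    is, the least singular value of M, and this can grow at most by the factor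
    ||T|| in M T. In a general Banach lattice there are no points, but
    | |f| - |g| | is still the infimum of the moduli |f - l g|
    ([cmodulus_phase_inf], and [modulus_sign_inf] over the reals). The reason
    is that, up to an error t |f|, the vector c f differs from |f| by a multiple
    of the defect |f| - Re (c f), and the infimum of this defect over unimodular
    c is 0 by the definition of the modulus. *)

(** * Order, modulus and norm *)

Section VectorLattice.
Context {R : realType} {X : banachLatticeType R}.
Implicit Types (x y z a b w : X) (k t : R).

Lemma levD2r z x y : (x + z <= y + z) = (x <= y).
Proof.
apply/idP/idP => [|h]; last exact: lev_wD2r.
by move=> h; have := @lev_wD2r _ _ (- z) _ _ h; rewrite !addrK.
Qed.

Lemma levD2l z x y : (z + x <= z + y) = (x <= y).
Proof. by rewrite ![z + _]addrC levD2r. Qed.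

Lemma levD x y a b : x <= y -> a <= b -> x + a <= y + b.
Proof.
by move=> xy ab; apply: (@le_trans _ _ (y + a)); rewrite ?levD2r ?levD2l.
Qed.

Lemma subv_ge0 x y : (0 <= y - x) = (x <= y).
Proof. by rewrite -[LHS](levD2r x) add0r subrK. Qed.

Lemma levN2 x y : (- x <= - y) = (y <= x).
Proof. by rewrite -[LHS]subv_ge0 opprK addrC subv_ge0. Qed.

Lemma levBlDr x y z : (x - y <= z) = (x <= z + y).
Proof. by rewrite -[LHS](levD2r y) subrK. Qed.

Lemma levBrDr x y z : (x <= y - z) = (x + z <= y).
Proof. by rewrite -[LHS](levD2r z) subrK. Qed.

Lemma subv_le0 x y : (x - y <= 0) = (x <= y).
Proof. by rewrite levBlDr add0r. Qed.

Lemma lev_wpZ2l k x y : 0 <= k -> x <= y -> k *: x <= k *: y.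
Proof.
move=> k0; rewrite -subv_ge0 -(subv_ge0 (k *: x)) -scalerBr.
exact: scalev_ge0.
Qed.

Lemma lev_wpZ2r x k t : 0 <= x -> k <= t -> k *: x <= t *: x.
Proof.
move=> x0; rewrite -subr_ge0 -(subv_ge0 (k *: x)) -scalerBl => kt.
exact: scalev_ge0.
Qed.

Lemma lev_pdivlMl k x y : 0 < k -> (x <= k^-1 *: y) = (k *: x <= y).
Proof.
move=> k0; apply/idP/idP => h.
  by have := lev_wpZ2l (ltW k0) h; rewrite scalerA divff ?gt_eqF// scale1r.
have k'0 : 0 <= k^-1 by rewrite invr_ge0 ltW.
by have := lev_wpZ2l k'0 h; rewrite scalerA mulVf ?gt_eqF// scale1r.
Qed.

Lemma modulus_le x b : (modulus x <= b) = (x <= b) && (- x <= b).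
Proof. by rewrite /modulus leUx. Qed.

Lemma le_modulus x : x <= modulus x.
Proof. by have := lexx (modulus x); rewrite {1}modulus_le => /andP[]. Qed.

Lemma leN_modulus x : - x <= modulus x.
Proof. by have := lexx (modulus x); rewrite {1}modulus_le => /andP[]. Qed.

Lemma modulusN x : modulus (- x) = modulus x.
Proof. by rewrite /modulus opprK joinC. Qed.

Lemma modulus_ge0 x : 0 <= modulus x.
Proof.
have : 0 <= modulus x + modulus x.
  by rewrite -(subrr x); apply: levD; [exact: le_modulus|exact: leN_modulus].
have half0 : (0 : R) <= 2^-1 by [].
move=> /(lev_wpZ2l half0).
by rewrite scaler0 -mulr2n -(scaler_nat _ (modulus x)) scalerA mulVf// scale1r.
Qed.

Lemma modulus_id x : 0 <= x -> modulus x = x.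
Proof.
move=> x0; apply/eqP; rewrite eq_le modulus_le lexx le_modulus/= andbT.
by apply: (le_trans _ x0); rewrite -levN2 opprK oppr0.
Qed.

Lemma modulusD x y : modulus (x + y) <= modulus x + modulus y.
Proof.
by rewrite modulus_le opprD !levD ?le_modulus ?leN_modulus.
Qed.

Lemma modulusZ_ge0 k x : 0 <= k -> modulus (k *: x) = k *: modulus x.
Proof.
rewrite le_eqVlt => /predU1P[<-|k0].
  by rewrite !scale0r modulus_id.
have k'0 : 0 < k^-1 by rewrite invr_gt0.
apply/eqP; rewrite eq_le; apply/andP; split.
  by rewrite modulus_le -scalerN !lev_wpZ2l ?(ltW k0) ?le_modulus ?leN_modulus.
rewrite -lev_pdivlMl// modulus_le.
have e : x = k^-1 *: (k *: x) by rewrite scalerA mulVf ?gt_eqF// scale1r.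
rewrite {1 3}e -scalerN !lev_wpZ2l ?(ltW k'0) ?le_modulus ?leN_modulus//.
Qed.

Lemma le_norm_modulus x y : modulus x <= modulus y -> `|x| <= `|y|.
Proof. exact: ler_normv. Qed.

Lemma norm_modulus x : `|modulus x| = `|x|.
Proof.
have e : modulus (modulus x) = modulus x by rewrite modulus_id ?modulus_ge0.
by apply/eqP; rewrite eq_le; apply/andP; split; apply: le_norm_modulus;
  rewrite e.
Qed.

Lemma le_norm x y : 0 <= x -> x <= y -> `|x| <= `|y|.
Proof.
move=> x0 xy; apply: le_norm_modulus.
by rewrite !modulus_id// (le_trans x0).
Qed.

(** The positive part of x is dominated by |y|, hence its norm by ||y||; being
    arbitrarily small in norm, it vanishes. Archimedeanness and the closedness
    of the order both rest on this. *)
Lemma lev_norm_le0 x :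
  (forall k : R, 0 < k -> exists2 y, x <= y & `|y| <= k) -> x <= 0.
Proof.
move=> h; suff /normr0_eq0 e0 : `|(x `|` 0)%O| = 0.
  by rewrite -[leRHS]e0 leUl.
apply/eqP; rewrite eq_le normr_ge0 andbT; apply/ler_addgt0Pr => k k0.
rewrite add0r; have [y xy yk] := h k k0; apply: le_trans yk.
rewrite -[leRHS]norm_modulus; apply: le_norm; first exact: leUr.
by rewrite leUx modulus_ge0 (le_trans xy) ?le_modulus.
Qed.

Lemma lev_archimedean x e :
  (forall k : R, 0 < k -> x <= k *: e) -> x <= 0.
Proof.
move=> h; apply: lev_norm_le0 => k k0; exists ((k / (`|e| + 1)) *: e).
  by apply: h; rewrite divr_gt0// ltr_pwDr.
have e1 : 0 < `|e| + 1 by rewrite ltr_pwDr.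
rewrite normrZ ger0_norm ?divr_ge0 ?(ltW k0) ?(ltW e1)// -mulrA.
by rewrite ler_piMr ?(ltW k0)// mulrC ler_pdivrMr// mul1r lerDl.
Qed.

Lemma lev_lim (s : nat -> X) l b :
  s @ \oo --> l -> (\forall n \near \oo, s n <= b) -> l <= b.
Proof.
move=> sl sb; rewrite -subv_le0.
apply: lev_norm_le0 => k k0.
have : \forall n \near \oo, `|l - s n| < k by exact: cvgr_dist_lt.
move=> slk; have [n /= [nb nk]] := @filter_ex _ _ _ _ (filterI sb slk).
exists (l - s n); first by rewrite levD2l levN2.
exact: ltW.
Qed.

Lemma lev_lim_ge (s : nat -> X) l b :
  s @ \oo --> l -> (\forall n \near \oo, b <= s n) -> b <= l.
Proof.
move=> sl sb; rewrite -levN2; apply: (@lev_lim (fun n => - s n)).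
  exact: cvgN.
by apply: filterS sb => n; rewrite levN2.
Qed.

(** * Existence of suprema *)

Lemma finite_sup x (l : seq X) : {s | forall b, (s <= b) = all (<= b) (x :: l)}.
Proof.
elim: l => [|y l [s hs]]; first by exists x => b /=; rewrite andbT.
by exists (s `|` y)%O => b; rewrite leUx hs/= -andbA; congr andb; rewrite andbC.
Qed.

(** A set whose supremum can be approached from below within k e for every
    k > 0 has a supremum: with s_n approximating within d_n e, d_n = 1/(n + 1),
    the s_n form a Cauchy sequence, since s_N + d_N e is an upper bound of the
    set and s_n lies below every upper bound.
    Their limit is the supremum because the order is closed. *)
Lemma uniform_approx_sup (A : set X) (e : X) : 0 <= e ->
  (forall k : R, 0 < k -> exists s,
     (forall b, ubound A b -> s <= b) /\ (forall a, A a -> a <= s + k *: e)) ->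
  exists m, supremums A m.
Proof.
move=> e0 happrox.
pose d n : R := n.+1%:R^-1.
have d0 n : 0 < d n by rewrite invr_gt0.
have dmono N n : (N <= n)%N -> d n <= d N.
  by move=> Nn; rewrite lef_pV2 ?posrE// ler_nat.
have /choice[s hs] n := happrox (d n) (d0 n).
have sub N n : (N <= n)%N -> modulus (s n - s N) <= d N *: e.
  move=> Nn; rewrite modulus_le opprB !levBlDr ![_ *: e + _]addrC.
  apply/andP; split; first by apply: (hs n).1 => a; exact: (hs N).2.
  apply: (hs N).1 => a /(hs n).2/le_trans; apply.
  by rewrite levD2l lev_wpZ2r// dmono.
have dlt (k : R) : 0 < k -> exists N, d N < k.
  move=> k0; exists (Num.truncn k^-1).
  by rewrite invf_plt ?posrE// truncnS_gt.
have cs : cvgn s.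
  apply: cauchy_cvg; apply: cauchy_exP => k k0.
  have e1 : 0 < `|e| + 1 by rewrite ltr_pwDr.
  have [|N dN] := dlt (k / (`|e| + 1)); first exact: divr_gt0.
  exists (s N); exists N => // n /= Nn; rewrite -ball_normE/= distrC.
  rewrite -[ltLHS]norm_modulus.
  apply: (le_lt_trans (le_norm (modulus_ge0 _) (sub _ _ Nn))).
  rewrite normrZ gtr0_norm//.
  move: dN; rewrite ltr_pdivlMr//; apply: le_lt_trans.
  by rewrite ler_wpM2l ?lerDl// ltW.
exists (lim (s @ \oo)); split=> [a Aa|b Ab].
  have lb N : a - d N *: e <= lim (s @ \oo).
    apply: (lev_lim_ge cs); exists N => // n /= Nn; rewrite levBlDr.
    apply: (le_trans ((hs n).2 _ Aa)).
    by rewrite levD2l lev_wpZ2r// dmono.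
  rewrite -subv_le0; apply: (@lev_archimedean _ e) => k k0.
  have [N dN] := dlt k k0; rewrite levBlDr addrC -levBlDr.
  apply: le_trans (lb N); rewrite levD2l levN2.
  exact: lev_wpZ2r (ltW dN).
by apply: (lev_lim cs); exists 0%N => // n _; apply: (hs n).1.
Qed.

End VectorLattice.

(** * The unit circle and complex scalars *)

Section CircleNet.
Context {R : realType}.
Implicit Types (s t k : R).

Lemma cos_sin_lipschitz s t :
  `|cos t - cos s| <= `|t - s| /\ `|sin t - sin s| <= `|t - s|.
Proof.
wlog st : s t / s <= t => [hw|].
  have [st|/ltW ts] := leP s t; first exact: hw.
  by rewrite (distrC (cos t)) (distrC (sin t)) (distrC t); exact: hw.
split.
- have [c _ ->] := @MVT_segment R cos (fun x => - sin x) s t st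
    (fun x _ => is_derive_cos x) (continuous_subspaceT (@continuous_cos R)).
  by rewrite normrM ler_piMl// normrN ler_norml sin_geN1 sin_le1.
- have [c _ ->] := @MVT_segment R sin cos s t st
    (fun x _ => is_derive_sin x) (continuous_subspaceT (@continuous_sin R)).
  by rewrite normrM ler_piMl// ler_norml cos_geN1 cos_le1.
Qed.

Lemma itv_net t k : 0 <= t -> 0 < k -> exists l : seq R,
  {in l, forall s, s \in `[0, t]} /\
  {in `[0, t], forall s, exists2 r, r \in l & `|s - r| <= k}.
Proof.
move=> t0 k0; pose N := (Num.truncn (t / k)).
exists [seq i%:R * k | i <- iota 0 N.+1]; split=> s.
  case/mapP => i; rewrite mem_iota add0n => /andP[_]; rewrite ltnS => iN ->.
  rewrite in_itv/= mulr_ge0 ?ler0n ?(ltW k0)//= -ler_pdivlMr//.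
  by rewrite -truncn_ge_nat// divr_ge0// ltW.
rewrite in_itv/= => /andP[s0 st].
have sk0 : 0 <= s / k by rewrite divr_ge0// ltW.
exists ((Num.truncn (s / k))%:R * k).
  apply/(@mapP _ _ _ (iota 0 N.+1)); exists (Num.truncn (s / k)) => //.
  rewrite mem_iota add0n ltnS/=; apply: le_truncn.
  by rewrite ler_pM2r ?invr_gt0.
have /andP[le1 lt1] := truncn_itv sk0.
rewrite ler_norml; move: le1 lt1; rewrite ler_pdivlMr// ltr_pdivrMr//.
rewrite -natr1 mulrDl mul1r => le1 lt1; apply/andP; split; lra.
Qed.

Lemma circle_angle a b : a ^+ 2 + b ^+ 2 = 1 :> R ->
  exists2 t, t \in `[0, 2 * pi] & a = cos t /\ b = sin t.
Proof.
move=> ab.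
have a1 : -1 <= a <= 1.
  rewrite -ler_norml -(@expr_le1 _ 2)// real_normK ?num_real// -ab.
  by rewrite lerDl sqr_ge0.
have sb : `|b| = sin (acos a).
  by rewrite sin_acos// -ab addrAC subrr add0r sqrtr_sqr.
have ca : cos (acos a) = a by rewrite acosK// in_itv.
have [p0 ppi] := (acos_ge0 a1, acos_lepi a1).
have [b0|/ltW b0] := leP 0 b.
  exists (acos a); last by rewrite -sb ger0_norm.
  by rewrite in_itv/=; apply/andP; split; lra.
(* the lower half circle, reached from the angle of (a, -b) *)
exists (2 * pi - acos a); first by rewrite in_itv/=; apply/andP; split; lra.
rewrite mulr_natl addrC cosD2pi sinD2pi.
by rewrite cosN ca sinN -sb ler0_norm ?opprK.
Qed.

End CircleNet.

Section ComplexScalars.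
Context {R : realType}.
Implicit Types (c z lam : R[i]) (a k : R).

Lemma normci : normc ('i%C : R[i]) = 1.
Proof. by rewrite /normc expr0n expr1n add0r sqrtr1. Qed.

Lemma normc_real a : normc (a%:C) = `|a|.
Proof. by rewrite /normc /= expr0n addr0 sqrtr_sqr. Qed.

Lemma normc_ge0 c : 0 <= normc c.
Proof. by case: c => a b; exact: sqrtr_ge0. Qed.

Lemma normc_conj c : normc (conjc c) = normc c.
Proof. by case: c => a b; rewrite /normc /= sqrrN. Qed.

Lemma normc_eq1 c : `|c| = 1 -> normc c = 1.
Proof. by case: c => a b /(congr1 (@complex.Re R)). Qed.

Lemma normc_unit_neq0 c : normc c = 1 -> c != 0.
Proof.
by move=> c1; apply: contra_eq_neq c1 => ->; rewrite normc0 eq_sym oner_eq0.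
Qed.

(** Take for z the conjugate of a square root of lam. *)
Lemma unit_phase lam : normc lam = 1 ->
  exists2 z : R[i], normc z = 1 & conjc z / z = lam.
Proof.
move=> l1; pose s := sqrtc lam.
have s2 : s * s = lam by rewrite -expr2 sqr_sqrtc.
have s1 : normc s = 1.
  have : normc s ^+ 2 = 1 by rewrite expr2 -normcM s2.
  by move=> h; apply/eqP; rewrite -(@eqrXn2 _ 2) ?normc_ge0// h expr1n.
exists (conjc s); first by rewrite normc_conj.
rewrite conjcK -s2; apply: (mulIf (normc_unit_neq0 (_ : normc (conjc s) = 1))).
  by rewrite normc_conj.
rewrite divfK; last by apply: normc_unit_neq0; rewrite normc_conj.
rewrite -mulrA -{1}[s]mulr1; congr (_ * _).
move: s1; case: (s) => a b ab1.
have ab : a ^+ 2 + b ^+ 2 = 1.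
  by rewrite -[LHS]sqr_sqrtr ?addr_ge0 ?sqr_ge0// [Num.sqrt _]ab1 expr1n.
apply/eqP; rewrite eq_complex /=; apply/andP; split; apply/eqP.
  by rewrite mulrN opprK -ab !expr2.
by rewrite mulrN [b * a]mulrC addNr.
Qed.

Lemma Re_Im_sum_le z :
  `|complex.Re z| + `|complex.Im z| <= Num.sqrt 2 * normc z.
Proof.
case: z => a b; rewrite /normc /= -sqrtrM//.
rewrite -[leLHS]ger0_norm ?addr_ge0// -sqrtr_sqr ler_sqrt; last first.
  by rewrite mulr_ge0// addr_ge0 ?sqr_ge0.
rewrite -(real_normK (num_real a)) -(real_normK (num_real b)) -subr_ge0.
rewrite (_ : _ - _ = (`|a| - `|b|) ^+ 2); last by ring.
exact: sqr_ge0.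
Qed.

Lemma normc_le_max z (N : R) :
  `|complex.Re z| <= N -> `|complex.Im z| <= N -> normc z <= Num.sqrt 2 * N.
Proof.
case: z => a b /= aN bN; have N0 : 0 <= N := le_trans (normr_ge0 a) aN.
rewrite /normc -[X in _ * X](ger0_norm N0) -sqrtr_sqr -sqrtrM//.
rewrite ler_sqrt ?mulr_ge0 ?sqr_ge0// mulr2n mulrDl mul1r.
rewrite -(real_normK (num_real a)) -(real_normK (num_real b)).
by rewrite lerD// ler_sqr ?nnegrE.
Qed.

End ComplexScalars.

(** * The modulus of a complexification *)

Section ComplexModulus.
Context {R : realType} {X : banachLatticeType R}.
Local Notation XC := (complexification X).
Implicit Types (z f g : XC) (c : R[i]) (b w : X).

Lemma cscaleE c z : c *: z =
  (complex.Re c *: z.1 - complex.Im c *: z.2,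
   complex.Re c *: z.2 + complex.Im c *: z.1) :> XC.
Proof. by []. Qed.

(** Two vectors of the circle cos t x + sin t y at nearby angles differ by a
    small multiple of |x| + |y|, so that the join over a fine net of angles
    approaches the supremum uniformly. *)
Lemma cmodulus_supremums z : supremums
  [set cos t *: z.1 + sin t *: z.2 | t in `[0, 2 * pi]] (cmodulus z).
Proof.
rewrite /cmodulus; set A := [set _ | _ in _].
have A0 : A != set0.
  apply/set0P; exists (cos 0 *: z.1 + sin 0 *: z.2); exists 0 => //=.
  by rewrite in_itv/= lexx mulr_ge0// pi_ge0.
rewrite /supremum (negbTE A0); apply: xgetPex.
have e0 : 0 <= modulus z.1 + modulus z.2.
  by rewrite -[leLHS]addr0 levD ?modulus_ge0.
apply: (uniform_approx_sup e0) => k k0.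
have [|l [lsub lnet]] := @itv_net R (2 * pi) k _ k0.
  by rewrite mulr_ge0// pi_ge0.
pose v t := cos t *: z.1 + sin t *: z.2.
have [s hs] := finite_sup (v 0) [seq v t | t <- l].
exists s; split=> [b Ab|_ [t /= tI <-]].
  rewrite hs /=; apply/andP; split.
    by apply: Ab; exists 0 => //=; rewrite in_itv/= lexx mulr_ge0// pi_ge0.
  by apply/allP => _ /mapP[t tl ->]; apply: Ab; exists t => //=; exact: lsub.
have [r rl trk] := lnet _ tI.
have rs : v r <= s.
  have := lexx s; rewrite {1}hs /= => /andP[_ /allP]; apply.
  exact: map_f.
have [lc ls] := cos_sin_lipschitz r t.
have bound (x : X) (a : R) : `|a| <= `|t - r| -> a *: x <= k *: modulus x.
  move=> ha; apply: (le_trans (le_modulus _)).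
  have [a0|/ltW a0] := leP 0 a.
    rewrite modulusZ_ge0// lev_wpZ2r ?modulus_ge0//.
    by rewrite (le_trans (ler_norm _))// (le_trans ha).
  rewrite -modulusN -scaleNr modulusZ_ge0 ?oppr_ge0//.
  rewrite lev_wpZ2r ?modulus_ge0//.
  by rewrite -(ler0_norm a0) (le_trans ha).
rewrite -[leLHS](subrK (v r)) addrC levD// /v opprD addrACA -!scalerBl.
by rewrite scalerDr levD// bound.
Qed.

Lemma Re_le_cmodulus c z : normc c = 1 -> (c *: z).1 <= cmodulus z.
Proof.
case: c => a b; rewrite /normc => ab1.
have : a ^+ 2 + (- b) ^+ 2 = 1.
  by rewrite sqrrN -[LHS]sqr_sqrtr ?addr_ge0 ?sqr_ge0// ab1 expr1n.
case/circle_angle => t tI [at_ bt].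
have [ub _] := cmodulus_supremums z; apply: ub; exists t => //=.
by rewrite -at_ -bt scaleNr.
Qed.

Lemma cmodulus_le z b :
  (forall c, normc c = 1 -> (c *: z).1 <= b) -> cmodulus z <= b.
Proof.
move=> h; have [_ lub] := cmodulus_supremums z; apply: lub => _ [t /= _ <-].
have := h (Complex (cos t) (- sin t)); rewrite /= scaleNr opprK; apply.
by rewrite /normc sqrrN cos2Dsin2 sqrtr1.
Qed.

(** With [cmodulus_le], [Re_le_cmodulus] describes |z| as the supremum of
    Re (c z) over unimodular c, a set that is unchanged when z is rotated. *)
Lemma cmodulus_rot c z : normc c = 1 -> cmodulus (c *: z) = cmodulus z.
Proof.
move=> c1; apply/eqP; rewrite eq_le.
apply/andP; split; apply: cmodulus_le => d d1.
  by rewrite scalerA Re_le_cmodulus// normcM d1 c1 mulr1.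
have c0 := normc_unit_neq0 c1.
have -> : d *: z = (d / c) *: (c *: z) by rewrite scalerA divfK.
rewrite Re_le_cmodulus//.
by rewrite normcM normcV d1 c1 invr1 mulr1.
Qed.

Lemma cmodulus_ge0 z : 0 <= cmodulus z.
Proof.
apply: (le_trans (modulus_ge0 z.1)); rewrite modulus_le; apply/andP; split.
  by have := Re_le_cmodulus z (@normc1 R); rewrite scale1r.
have := @Re_le_cmodulus (-1) z; rewrite scaleN1r; apply.
by rewrite normcN normc1.
Qed.

Lemma cmodulusD f g : cmodulus (f + g) <= cmodulus f + cmodulus g.
Proof.
by apply: cmodulus_le => c c1; rewrite scalerDr levD// Re_le_cmodulus.
Qed.

Lemma cmodulusZ_ge0 (k : R) z :
  0 <= k -> cmodulus (k%:C *: z) = k *: cmodulus z.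
Proof.
rewrite le_eqVlt => /predU1P[<-|k0].
  rewrite !scale0r; apply/eqP; rewrite eq_le cmodulus_ge0 andbT.
  by apply: cmodulus_le => c _; rewrite scaler0.
have sc c : (c *: (k%:C *: z)).1 = k *: (c *: z).1.
  rewrite scalerA mulrC -scalerA.
  by rewrite [in LHS]cscaleE/= scale0r subr0.
apply/eqP; rewrite eq_le; apply/andP; split.
  by apply: cmodulus_le => c c1; rewrite sc lev_wpZ2l ?(ltW k0) ?Re_le_cmodulus.
rewrite -lev_pdivlMl//; apply: cmodulus_le => c c1.
by rewrite lev_pdivlMl// -sc Re_le_cmodulus.
Qed.

Lemma cmodulusZ c z : cmodulus (c *: z) = normc c *: cmodulus z.
Proof.
have [->|c0] := eqVneq c 0.
  by rewrite normc0 -(cmodulusZ_ge0 z (lexx 0)).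
have n0 : normc c != 0 by apply: contra_neq c0 => /eq0_normc.
have nn := normc_ge0 c.
have -> : c *: z = (normc c)%:C *: ((c / (normc c)%:C) *: z).
  rewrite scalerA mulrC divfK//; apply: contra_neq n0.
  by move=> /(congr1 (@complex.Re R)).
rewrite cmodulusZ_ge0// cmodulus_rot// normcM normcV.
by rewrite normc_real ger0_norm// divff.
Qed.

Lemma cmodulusN z : cmodulus (- z) = cmodulus z.
Proof. by rewrite -scaleN1r cmodulusZ normcN normc1 scale1r. Qed.

Lemma cmodulus_real (x : X) : cmodulus ((x, 0) : XC) = modulus x.
Proof.
apply/eqP; rewrite eq_le; apply/andP; split.
  apply: cmodulus_le => -[a b]; rewrite /normc /= scaler0 subr0 => ab1.
  have a1 : `|a| <= 1.
    rewrite -ab1 -[leLHS]sqrtr_sqr ler_sqrt ?addr_ge0 ?sqr_ge0//.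
    by rewrite lerDl sqr_ge0.
  have xa : modulus (a *: x) <= `|a| *: modulus x.
    rewrite -modulusZ_ge0//; case: (ger0P a) => // _.
    by rewrite scaleNr modulusN.
  apply: (le_trans (le_modulus _)); apply: (le_trans xa).
  by rewrite -[leRHS]scale1r lev_wpZ2r ?modulus_ge0.
rewrite modulus_le; apply/andP; split.
  by have := Re_le_cmodulus ((x, 0) : XC) (@normc1 R); rewrite scale1r.
have := @Re_le_cmodulus (-1) ((x, 0) : XC); rewrite scaleN1r; apply.
by rewrite normcN normc1.
Qed.

End ComplexModulus.

(** * The modulus of a difference of moduli as an infimum over phases *)

Section PhaseAlignment.
Context {R : realType} {X : banachLatticeType R}.
Local Notation XC := (complexification X).
Implicit Types (z f g : XC) (c d : R[i]) (b w : X).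

(** The defects |f| - Re (c f) have infimum 0, since |f| is the supremum of
    the Re (c f). *)
Lemma phase_defect_inf f b :
  (forall c, normc c = 1 -> b <= cmodulus f - (c *: f).1) -> b <= 0.
Proof.
move=> h; rewrite -(levD2l (cmodulus f - b)) subrK addr0.
by apply: cmodulus_le => c /h; rewrite levBrDr addrC -levBrDr.
Qed.

Lemma Re_leM_cmodulus c z : (c *: z).1 <= normc c *: cmodulus z.
Proof.
rewrite -cmodulusZ.
by have := Re_le_cmodulus (c *: z) (@normc1 R); rewrite scale1r.
Qed.

(** If Re z is close to |z|, then Im z is small. For functions this is
    Pythagoras; here it has to come from finitely many of the linear
    inequalities that define |z|. The scalars (1 -+ i t)^2, of modulus 1 + t^2,
    give (1 - t^2) Re z +- 2 t Im z <= (1 + t^2) |z|, which is linear in the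
    defect |z| - Re z. *)
Lemma Im_le_cmodulus z (t : R) : 0 < t ->
  modulus z.2 <= t *: cmodulus z + (2 * t)^-1 *: (cmodulus z - z.1).
Proof.
move=> t0; have t2 : 0 < 2 * t by rewrite mulr_gt0.
have r0 : 0 <= cmodulus z - z.1.
  by rewrite subv_ge0; have := Re_le_cmodulus z (@normc1 R); rewrite scale1r.
have n s : s = 2 * t \/ s = - (2 * t) ->
    normc (Complex (1 - t ^+ 2) s) = 1 + t ^+ 2.
  move=> hs; rewrite /normc.
  have -> : s ^+ 2 = (2 * t) ^+ 2 by case: hs => ->; rewrite ?sqrrN.
  rewrite (_ : _ ^+ 2 + _ ^+ 2 = (1 + t ^+ 2) ^+ 2); last by ring.
  by rewrite sqrtr_sqr ger0_norm// addr_ge0// sqr_ge0.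
have -> : t *: cmodulus z + (2 * t)^-1 *: (cmodulus z - z.1) =
    (2 * t)^-1 *: ((2 * t ^+ 2) *: cmodulus z + (cmodulus z - z.1)).
  rewrite [RHS]scalerDr scalerA; congr (_ *: _ + _); field.
  by rewrite gt_eqF.
have key y : y = z.2 \/ y = - z.2 ->
    (2 * t) *: y <= (2 * t ^+ 2) *: cmodulus z + (cmodulus z - z.1).
  move=> hy.
  apply: (@le_trans _ _ ((2 * t ^+ 2) *: cmodulus z +
                         (1 - t ^+ 2) *: (cmodulus z - z.1))); last first.
    by rewrite levD2l -[leRHS]scale1r lev_wpZ2r// lerBlDr lerDl sqr_ge0.
  rewrite scalerBr addrA levBrDr -scalerDl.
  rewrite (_ : 2 * t ^+ 2 + _ = 1 + t ^+ 2); last by ring.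
  case: hy => ->.
    have := Re_leM_cmodulus (Complex (1 - t ^+ 2) (- (2 * t))) z.
    by rewrite n /=; [rewrite scaleNr opprK addrC|right].
  have := Re_leM_cmodulus (Complex (1 - t ^+ 2) (2 * t)) z.
  by rewrite n /=; [rewrite scalerN addrC|left].
by rewrite modulus_le !lev_pdivlMl// !key//; [right|left].
Qed.

(** Rotating f by c with a small defect |f| - Re (c f) brings it close to |f|:
    the real part is off by the defect, the imaginary part is bounded by
    [Im_le_cmodulus]. *)
Lemma phase_alignment f c (t : R) : normc c = 1 -> 0 < t ->
  cmodulus (c *: f - ((cmodulus f, 0) : XC)) <=
  t *: cmodulus f + (1 + (2 * t)^-1) *: (cmodulus f - (c *: f).1).
Proof.
move=> c1 t0.
have -> : c *: f - ((cmodulus f, 0) : XC) =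
    (((c *: f).1 - cmodulus f, 0) : XC) + 'i%C *: (((c *: f).2, 0) : XC).
  case: (c *: f) => x y; rewrite cscaleE /= !scale1r !scale0r subrr add0r.
  rewrite -[LHS]/(x - cmodulus f, y - 0) -[RHS]/(_ + 0, 0 + y).
  by rewrite subr0 addr0 add0r.
apply: le_trans (cmodulusD _ _) _.
rewrite cmodulusZ normci scale1r.
rewrite !cmodulus_real -modulusN opprB modulus_id; last first.
  by rewrite subv_ge0 Re_le_cmodulus.
rewrite scalerDl scale1r addrCA levD2l.
by have := Im_le_cmodulus (c *: f) t0; rewrite cmodulus_rot.
Qed.

(** As c and d range independently over the unit circle, so does d / c, and
    |f - (d / c) g| = |c f - d g|. The latter exceeds | |f| - |g| | by
    at most small multiples of |f| and |g| and multiples of the defects of c f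
    and d g, whose infimum over c and d is 0. *)
Lemma cmodulus_phase_inf f g w :
  (forall lam, normc lam = 1 -> w <= cmodulus (f - lam *: g)) ->
  w <= modulus (cmodulus f - cmodulus g).
Proof.
move=> hw; rewrite -subv_le0.
apply: (@lev_archimedean _ _ _ (cmodulus f + cmodulus g)) => t t0.
rewrite -subv_le0.
set A := _ - t *: _; pose K := 1 + (2 * t)^-1.
have K0 : 0 < K by rewrite addr_gt0// invr_gt0 mulr_gt0.
have main c d : normc c = 1 -> normc d = 1 ->
    A <= K *: (cmodulus f - (c *: f).1) + K *: (cmodulus g - (d *: g).1).
  move=> c1 d1.
  have c0 := normc_unit_neq0 c1.
  have dec : cmodulus (f - (d / c) *: g) <=
      cmodulus (c *: f - ((cmodulus f, 0) : XC)) +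
      cmodulus (d *: g - ((cmodulus g, 0) : XC)) +
      modulus (cmodulus f - cmodulus g).
    rewrite -(cmodulus_rot _ c1) scalerBr scalerA mulrCA divff// mulr1.
    have -> : c *: f - d *: g =
        (c *: f - ((cmodulus f, 0) : XC)) - (d *: g - ((cmodulus g, 0) : XC))
        + ((cmodulus f - cmodulus g, 0) : XC).
      have -> : ((cmodulus f - cmodulus g, 0) : XC) =
          ((cmodulus f, 0) : XC) - ((cmodulus g, 0) : XC).
        by rewrite -[RHS]/(cmodulus f - cmodulus g, 0 - 0) subr0.
      by rewrite opprB -addrA [X in _ = _ + X]addrC !subrKA.
    rewrite -cmodulus_real -(cmodulusN (d *: g - _)).
    by apply: le_trans (cmodulusD _ _) _; rewrite levD2r cmodulusD.
  rewrite /A !levBlDr (scalerDr t) addrACA.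
  apply: (le_trans (hw (d / c) _)).
    by rewrite normcM normcV d1 c1 invr1 mulr1.
  apply: (le_trans dec); rewrite levD2r ![K *: _ + _]addrC.
  by apply: levD; exact: phase_alignment.
have K'0 : 0 <= K^-1 by rewrite invr_ge0 ltW.
have main' c d : normc c = 1 -> normc d = 1 ->
    K^-1 *: A - (cmodulus g - (d *: g).1) <= cmodulus f - (c *: f).1.
  move=> c1 d1; rewrite levBlDr.
  have := lev_wpZ2l K'0 (main c d c1 d1).
  by rewrite -scalerDr [X in _ <= X]scalerA mulVf ?gt_eqF// scale1r.
have A0 : K^-1 *: A <= 0.
  apply: (phase_defect_inf (f := g)) => d d1; rewrite -subv_le0.
  by apply: (phase_defect_inf (f := f)) => c c1; exact: main'.
have := lev_wpZ2l (ltW K0) A0.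
by rewrite scalerA divff ?gt_eqF// scale1r scaler0.
Qed.

End PhaseAlignment.

(** * The norm of a complexification *)

Section ComplexNorm.
Context {R : realType} {X : banachLatticeType R}.
Local Notation XC := (complexification X).
Implicit Types (f g : XC) (c : R[i]).

Lemma cnorm_ge0 f : 0 <= cnorm f.
Proof. exact: normr_ge0. Qed.

Lemma cnormZ c f : cnorm (c *: f) = normc c * cnorm f.
Proof. by rewrite /cnorm cmodulusZ normrZ ger0_norm ?normc_ge0. Qed.

Lemma cnormN f : cnorm (- f) = cnorm f.
Proof. by rewrite /cnorm cmodulusN. Qed.

Lemma cnormD f g : cnorm (f + g) <= cnorm f + cnorm g.
Proof.
apply: le_trans (ler_normD _ _); apply: le_norm (cmodulusD _ _).
exact: cmodulus_ge0.
Qed.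

Lemma cmodulus_dist f g : modulus (cmodulus f - cmodulus g) <= cmodulus (f - g).
Proof.
rewrite modulus_le opprB !levBlDr; apply/andP; split.
  by rewrite -{1}[f](subrK g) cmodulusD.
by rewrite -(cmodulusN (f - g)) opprB -{1}[g](subrK f) cmodulusD.
Qed.

End ComplexNorm.

(** * Nearly Auerbach bases of the plane *)

Section NearAuerbach.
Context {R : realType}.
Implicit Types (z : R[i]) (a b k : R).

Definition area z1 z2 : R :=
  complex.Re z1 * complex.Im z2 - complex.Im z1 * complex.Re z2.

Lemma area_le z1 z2 : `|area z1 z2| <= normc z1 * normc z2.
Proof.
case: z1 z2 => [a b] [c d]; rewrite /area /normc /=.
rewrite -sqrtrM ?addr_ge0 ?sqr_ge0//.
rewrite -[leLHS]sqrtr_sqr ler_sqrt; last by rewrite mulr_ge0 ?addr_ge0 ?sqr_ge0.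
rewrite -subr_ge0 (_ : _ - _ = (a * c + b * d) ^+ 2); last by ring.
exact: sqr_ge0.
Qed.

Lemma areaZl k z1 z2 : area (k%:C * z1) z2 = k * area z1 z2.
Proof. by case: z1 z2 => [a b] [c d]; rewrite /area /=; ring. Qed.

Lemma areaZr k z1 z2 : area z1 (k%:C * z2) = k * area z1 z2.
Proof. by case: z1 z2 => [a b] [c d]; rewrite /area /=; ring. Qed.

Lemma area_combl a b z1 z2 :
  area (a%:C * z1 + b%:C * z2) z2 = a * area z1 z2.
Proof. by case: z1 z2 => [? ?] [? ?]; rewrite /area /=; ring. Qed.

Lemma area_combr a b z1 z2 :
  area z1 (a%:C * z1 + b%:C * z2) = b * area z1 z2.
Proof. by case: z1 z2 => [? ?] [? ?]; rewrite /area /=; ring. Qed.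

(** Cramer's rule. *)
Lemma area_basis z1 z2 z : area z1 z2 != 0 ->
  z = (area z z2 / area z1 z2)%:C * z1 + (area z1 z / area z1 z2)%:C * z2.
Proof.
case: z1 z2 z => [? ?] [? ?] [? ?]; rewrite /area /= => nz.
by apply/eqP; rewrite eq_complex /=; apply/andP; split; apply/eqP; field.
Qed.

(** Choose z1, z2 in the unit ball of n with nearly maximal area: replacing z1
    by a vector x = a z1 + b z2 multiplies the area by |a|, and by maximality
    it cannot exceed the supremum D times n x. The factor 1 - eta
    bounds the ratio between the area of (z1, z2) and D from below. *)
Lemma near_auerbach (n : R[i] -> R) (d eta : R) : 0 < d -> 0 < eta <= 1 ->
  (forall k z, n (k%:C * z) = `|k| * n z) ->
  (forall z, d * normc z <= n z) ->
  exists z1 z2, [/\ n z1 <= 1, n z2 <= 1, area z1 z2 != 0 &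
    forall a b, (1 - eta) * `|a| <= n (a%:C * z1 + b%:C * z2) /\
                (1 - eta) * `|b| <= n (a%:C * z1 + b%:C * z2)].
Proof.
move=> d0 /andP[eta0 eta1] nZ nd.
pose A := [set r | exists z1 z2, [/\ n z1 <= 1, n z2 <= 1 & r = `|area z1 z2|]].
have n0 z : 0 <= n z.
  by apply: le_trans (nd z); rewrite mulr_ge0 ?normc_ge0 ?ltW.
have nd' z : n z <= 1 -> normc z <= d^-1.
  move=> z1; rewrite -[d^-1]mul1r ler_pdivlMr// mulrC.
  exact: le_trans (nd z) z1.
have ubA : has_ubound A.
  exists (d^-1 * d^-1) => _ [z1 [z2 [h1 h2 ->]]].
  by apply: le_trans (area_le _ _) _; rewrite ler_pM ?normc_ge0 ?nd'.
have [r rA r0] : exists2 r, A r & 0 < r.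
  have npos z : normc z = 1 -> 0 < n z.
    by move=> z1; apply: lt_le_trans (nd z); rewrite z1 mulr1.
  have p1 := npos 1 (@normc1 R); have pi := npos _ (@normci R).
  exists `|area ((n 1)^-1%:C * 1) ((n 'i%C)^-1%:C * 'i%C)|.
    exists ((n 1)^-1%:C * 1), ((n 'i%C)^-1%:C * 'i%C).
    by split; rewrite // nZ gtr0_norm ?invr_gt0// mulVf// gt_eqF.
  rewrite areaZl areaZr normr_gt0 !mulf_neq0 ?invr_neq0 ?gt_eqF//.
  by rewrite /area /= mulr1 mul0r subr0 ltr01.
pose D := sup A.
have D0 : 0 < D by apply: lt_le_trans r0 _; exact: ub_le_sup.
have hsA : has_sup A by split=> //; exists r.
have [|_ [z1 [z2 [h1 h2 ->]]] hz] := @sup_adherent _ A (eta * D) _ hsA.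
  exact: mulr_gt0.
have lt1 : (1 - eta) * D < `|area z1 z2| by rewrite mulrBl mul1r.
(* homogeneity extends the maximality of D to arbitrary first arguments *)
have bound x y : n y <= 1 -> `|area x y| <= D * n x.
  move=> y1; have [/eqP nx0|nx0] := eqVneq (n x) 0.
    have x0 : normc x <= 0.
      by rewrite -(pmulr_rle0 _ d0) (le_trans (nd x))// (eqP nx0).
    rewrite (eqP nx0) mulr0; apply: le_trans (area_le _ _) _.
    by rewrite mulr_le0_ge0// normc_ge0.
  have nxp : 0 < n x by rewrite lt_def nx0 n0.
  rewrite -ler_pdivrMr// mulrC -[X in X * _]gtr0_norm ?invr_gt0//.
  rewrite -normrM -areaZl.
  apply: ub_le_sup => //; exists ((n x)^-1%:C * x), y; split=> //.
  by rewrite nZ gtr0_norm ?invr_gt0// mulVf ?gt_eqF.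
have areaC x y : `|area x y| = `|area y x|.
  by rewrite -normrN /area; congr `|_|; ring.
have fin (c N : R) : `|c| * `|area z1 z2| <= D * N -> (1 - eta) * `|c| <= N.
  move=> h; rewrite -(ler_pM2l D0); apply: le_trans h.
  by rewrite mulrA [`|c| * _]mulrC ler_wpM2r// mulrC ltW.
exists z1, z2; split=> //.
  rewrite -normr_gt0; apply: le_lt_trans lt1.
  by rewrite mulr_ge0 ?subr_ge0 ?(ltW D0).
move=> a b; split; apply: fin.
  by rewrite -normrM -(area_combl a b); exact: bound.
by rewrite -normrM -(area_combr a b) areaC; exact: bound.
Qed.

End NearAuerbach.

(** * From rescaled pairs to stable phase retrieval *)

Section Bootstrap.
Context {R : realType} {X : banachLatticeType R}.
Context {K : numFieldType} {V : lmodType K} (nrm : V -> R) (md : V -> X).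
Context (nrm_ge0 : forall f, 0 <= nrm f).

Lemma phase_dist_le f g lam :
  `|lam| = 1 -> phase_dist nrm f g <= nrm (f - lam *: g).
Proof.
move=> l1; have lb : has_lbound
    [set nrm (f - lam *: g) | lam in [set lam : K | `|lam| = 1]].
  by exists 0 => _ [? _ <-].
by apply: (ge_inf lb); exists lam.
Qed.

Lemma le_phase_dist f g (k : R) :
  (forall lam, `|lam| = 1 -> k <= nrm (f - lam *: g)) ->
  k <= phase_dist nrm f g.
Proof.
move=> h; apply: lb_le_inf.
  by exists (nrm (f - 1 *: g)); exists 1 => //=; rewrite normr1.
by move=> _ [lam /= l1 <-]; exact: h.
Qed.

(** The Hoelder inequality on the rescaled pair reads
    (1 - eta) / sqrt 2 <= C (sqrt 2 e / d)^gam 2^(1 - gam). Its bounds no longer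
    depend on the pair, so that eta can go to 0 and the inequality can be
    solved for d. *)
Lemma holder_SPR_rescaled (E : {pred V}) gam C :
  0 < gam -> gam <= 1 -> 0 < C -> holder_SPR nrm md E gam C ->
  (forall f g eta, f \in E -> g \in E ->
      0 < phase_dist nrm f g -> 0 < eta <= 1 ->
    exists f' g', [/\ f' \in E, g' \in E, nrm f' + nrm g' <= 2,
      `|md f' - md g'| <= Num.sqrt 2 / phase_dist nrm f g * `|md f - md g| &
      (1 - eta) / Num.sqrt 2 <= phase_dist nrm f' g']) ->
  SPR nrm md E (Num.sqrt 2 * (Num.sqrt 8 * C) `^ gam^-1).
Proof.
move=> gam0 gam1 C0 hE hpair f g fE gE.
set d := phase_dist _ _ _; set e := `|_|.
have s2 : 0 < Num.sqrt 2 :> R by rewrite sqrtr_gt0.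
have [d0|d0] := leP d 0.
  by apply: (le_trans d0); rewrite !mulr_ge0 ?powR_ge0 ?sqrtr_ge0// normr_ge0.
pose x := Num.sqrt 2 / d * e.
have x0 : 0 <= x by rewrite mulr_ge0 ?divr_ge0 ?(ltW s2) ?(ltW d0) ?normr_ge0.
have s8 : Num.sqrt 8 = Num.sqrt 2 * 2 :> R.
  rewrite (_ : 8 = 2 * 2 ^+ 2); last by ring.
  by rewrite sqrtrM// sqrtr_sqr ger0_norm.
(* sqrt 8 = sqrt 2 * 2: the factor sqrt 2 comes from the distance of the
   rescaled pair, the factor 2 from its norms *)
have bound : 1 <= Num.sqrt 8 * C * x `^ gam.
  apply/ler_addgt0Pr => eta eta0.
  have [eta1|/ltW eta1] := leP eta 1; last first.
    by rewrite (le_trans eta1)// lerDr !mulr_ge0 ?sqrtr_ge0 ?powR_ge0// ltW.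
  have [|f' [g' [f'E g'E nfg mfg dfg]]] := hpair f g eta fE gE d0.
    by rewrite eta0.
  have := le_trans dfg (hE f' g' f'E g'E).
  rewrite ler_pdivrMr// -lerBlDr => /le_trans; apply.
  have hx : `|md f' - md g'| `^ gam <= x `^ gam.
    by rewrite ge0_ler_powR ?nnegrE ?(ltW gam0).
  have h2 : (nrm f' + nrm g') `^ (1 - gam) <= 2.
    apply: (@le_trans _ _ (2 `^ (1 - gam))).
      by rewrite ge0_ler_powR ?subr_ge0 ?nnegrE ?addr_ge0.
    rewrite -[leRHS](@powRr1 R)// ler_powR ?ler1n//.
    by rewrite lerBlDr lerDl ltW.
  rewrite s8 (_ : _ * _ * x `^ gam = C * x `^ gam * 2 * Num.sqrt 2);
    last by ring.
  rewrite ler_wpM2r ?(ltW s2)//.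
  rewrite ler_pM ?powR_ge0 ?mulr_ge0 ?powR_ge0 ?(ltW C0)//.
  by rewrite ler_wpM2l ?(ltW C0).
have : (1 : R) `^ gam^-1 <= (Num.sqrt 8 * C * x `^ gam) `^ gam^-1.
  rewrite ge0_ler_powR ?invr_ge0 ?(ltW gam0)// nnegrE ?ler01//.
  by rewrite !mulr_ge0 ?sqrtr_ge0 ?powR_ge0// ltW.
have sC : 0 <= Num.sqrt 8 * C by rewrite mulr_ge0 ?sqrtr_ge0 ?(ltW C0).
rewrite powR1 powRM ?powR_ge0// -powRrM divff ?gt_eqF// powRr1// /x.
set W := _ `^ _ => h.
have : d * 1 <= d * (W * (Num.sqrt 2 / d * e)) by rewrite ler_wpM2l ?(ltW d0).
rewrite mulr1 (_ : d * (W * (_ / d * e)) = Num.sqrt 2 * W * e)//.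
by field; rewrite gt_eqF.
Qed.

End Bootstrap.

(** * Real Banach lattices *)

Section RealCase.
Context {R : realType} {X : banachLatticeType R}.
Implicit Types (f g w : X).

Lemma sign_defect_inf f w :
  w <= modulus f - f -> w <= modulus f + f -> w <= 0.
Proof.
move=> h1 h2; rewrite -(levD2l (modulus f - w)) subrK addr0 modulus_le.
apply/andP; split; first by move: h1; rewrite levBrDr addrC -levBrDr.
by rewrite levBrDr addrC levBlDr.
Qed.

(** The real counterpart of [cmodulus_phase_inf], with two signs as phases:
    |u - v| exceeds | |f| - |g| | by at most the sum of the defects
    |f| - u and |g| - v, for u = f or -f and v = g or -g. *)
Lemma modulus_sign_inf f g w :
  w <= modulus (f - g) -> w <= modulus (f + g) ->
  w <= modulus (modulus f - modulus g).
Proof.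
move=> wB wD; rewrite -subv_le0; set A := _ - modulus _.
have main u v : w <= modulus (u - v) -> modulus u = modulus f ->
    modulus v = modulus g -> A <= (modulus f - u) + (modulus g - v).
  move=> wuv uf vg; rewrite levBlDr; apply: (le_trans wuv).
  have -> : u - v =
      - (modulus f - u) + (modulus g - v) + (modulus f - modulus g).
    by rewrite opprB -addrA (addrC (modulus g - v)) !subrKA.
  apply: (le_trans (modulusD _ _)); rewrite levD2r.
  have r0 : 0 <= modulus f - u by rewrite subv_ge0 -uf le_modulus.
  have s0 : 0 <= modulus g - v by rewrite subv_ge0 -vg le_modulus.
  apply: (le_trans (modulusD _ _)).
  by rewrite modulusN !(modulus_id r0, modulus_id s0).
have half u : modulus u = modulus f ->
    (w <= modulus (u - g)) -> (w <= modulus (u + g)) -> A <= modulus f - u.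
  move=> uf w1 w2; rewrite -subv_le0.
  apply: (@sign_defect_inf g); rewrite levBlDr addrC.
    exact: main.
  rewrite -{2}[g]opprK; apply: main; rewrite ?opprK ?modulusN//.
apply: (@sign_defect_inf f); first exact: half.
rewrite -{2}[f]opprK; apply: half; rewrite ?modulusN//.
  by rewrite -opprD modulusN.
by rewrite -modulusN opprD opprK.
Qed.

Lemma modulus_dist f g : modulus (modulus f - modulus g) <= modulus (f - g).
Proof.
rewrite modulus_le opprB !levBlDr; apply/andP; split.
  by rewrite -{1}[f](subrK g) modulusD.
by rewrite -(modulusN (f - g)) opprB -{1}[g](subrK f) modulusD.
Qed.

(** For a pair with f' + g' and f' - g' of norm 1 the distance is 1 and the
    norms are at most 1. Since ||f + g||, ||f - g|| >= d, normalising f + g and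
    f - g multiplies their moduli by at most 1/d. *)
Lemma real_rescaled_pair (E : {pred X}) f g :
  GRing.submod_closed E -> f \in E -> g \in E ->
  0 < phase_dist (Num.norm : X -> R) f g ->
  exists f' g', [/\ f' \in E, g' \in E, `|f'| + `|g'| <= 2 :> R,
    `|modulus f' - modulus g'|
      <= (phase_dist Num.norm f g)^-1 * `|modulus f - modulus g| &
    1 <= phase_dist (Num.norm : X -> R) f' g'].
Proof.
move=> [E0 EZ] fE gE; set d := phase_dist _ _ _ => d0.
have nu : d <= `|f + g|.
  have := @phase_dist_le _ _ _ (Num.norm : X -> R) (@normr_ge0 _ X) f g (-1).
  by rewrite scaleN1r opprK normrN1; apply.
have nv : d <= `|f - g|.
  have := @phase_dist_le _ _ _ (Num.norm : X -> R) (@normr_ge0 _ X) f g 1.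
  by rewrite scale1r normr1; apply.
have EZ' (k : R) x : x \in E -> k *: x \in E.
  by move=> xE; rewrite -[_ *: _]addr0; exact: EZ.
have ED x y : x \in E -> y \in E -> x + y \in E.
  by move=> xE yE; rewrite -[x]scale1r; exact: EZ.
have EB x y : x \in E -> y \in E -> x - y \in E.
  by move=> xE yE; rewrite -(scaleN1r y); apply: (ED) => //; exact: EZ'.
have u0 : 0 < `|f + g| := lt_le_trans d0 nu.
have v0 : 0 < `|f - g| := lt_le_trans d0 nv.
pose u := `|f + g|^-1 *: (f + g); pose v := `|f - g|^-1 *: (f - g).
have nu1 : `|u| = 1 by rewrite normrZ gtr0_norm ?invr_gt0// mulVf ?gt_eqF.
have nv1 : `|v| = 1 by rewrite normrZ gtr0_norm ?invr_gt0// mulVf ?gt_eqF.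
have h2 : (2^-1 + 2^-1 : R) = 1 by field.
pose f' := 2^-1 *: (u + v); pose g' := 2^-1 *: (u - v).
have fgD : f' + g' = u.
  by rewrite -scalerDr addrACA subrr addr0 scalerDr -scalerDl h2 scale1r.
have fgB : f' - g' = v.
  rewrite -scalerBr opprB [u + v]addrC addrACA subrr addr0.
  by rewrite scalerDr -scalerDl h2 scale1r.
have uE : u \in E by apply: (EZ'); exact: ED.
have vE : v \in E by apply: (EZ'); exact: EB.
exists f', g'; split.
- by apply: (EZ'); exact: ED.
- by apply: (EZ'); exact: EB.
- have le1 x y : `|x| = 1 -> `|y| = 1 -> `|2^-1 *: (x + y)| <= 1 :> R.
    move=> x1 y1; rewrite normrZ gtr0_norm// ler_pdivrMl// mulr1.
    by apply: le_trans (ler_normD _ _) _; rewrite x1 y1.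
  by rewrite -[2%:R]/(1 + 1) lerD// le1// normrN.
- have scaled x y : modulus x <= modulus (`|y|^-1 *: y) -> d <= `|y| ->
      d *: modulus x <= modulus y.
    move=> xy dy; have y0 : 0 < `|y| := lt_le_trans d0 dy.
    apply: (le_trans (lev_wpZ2l (ltW d0) xy)).
    rewrite modulusZ_ge0 ?invr_ge0// scalerA -[leRHS]scale1r.
    by rewrite lev_wpZ2r ?modulus_ge0// ler_pdivrMr// mul1r.
  have key : d *: modulus (modulus f' - modulus g')
      <= modulus (modulus f - modulus g).
    apply: modulus_sign_inf; apply: scaled => //.
      by rewrite -/v -fgB modulus_dist.
    by rewrite -/u -fgD -[g' in leRHS]opprK -(modulusN g') modulus_dist.
  rewrite ler_pdivlMl// -(norm_modulus (modulus f' - _)).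
  rewrite -(norm_modulus (modulus f - _)) -[X in X * _](gtr0_norm d0) -normrZ.
  apply: le_norm key.
  exact: scalev_ge0 (ltW d0) (modulus_ge0 _).
- apply: le_phase_dist => lam /eqP.
  rewrite eqr_norml ler01 andbT => /orP[]/eqP->.
    by rewrite scale1r fgB nv1.
  by rewrite scaleN1r opprK fgD nu1.
Qed.

End RealCase.

(** * Complex Banach lattices *)

Section ComplexCase.
Context {R : realType} {X : banachLatticeType R}.
Local Notation XC := (complexification X).
Implicit Types (f g : XC) (z c lam : R[i]) (a b : R).

(** By [phase_planeE], unimodular z give the vectors f - lam g up to a phase;
    unlike these, the parametrisation by z is real-linear. *)
Definition phase_plane f g z : XC := z *: f - conjc z *: g.

Lemma phase_planeE f g z lam : conjc z / z = lam -> normc z = 1 ->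
  phase_plane f g z = z *: (f - lam *: g).
Proof.
move=> <- /normc_unit_neq0 z0.
by rewrite /phase_plane scalerBr scalerA mulrCA divff// mulr1.
Qed.

Lemma phase_plane_lin f g a b z1 z2 :
  phase_plane f g (a%:C * z1 + b%:C * z2) =
  a%:C *: phase_plane f g z1 + b%:C *: phase_plane f g z2.
Proof.
rewrite /phase_plane rmorphD !rmorphM /= !oppr0 !scalerDl -!scalerA.
by rewrite !scalerBr opprD addrACA.
Qed.

Lemma phase_planeZ f g a z :
  phase_plane f g (a%:C * z) = a%:C *: phase_plane f g z.
Proof.
by have := phase_plane_lin f g a 0 z 0; rewrite !mul0r !scale0r !addr0.
Qed.

Lemma cnorm_phase_plane f g z :
  phase_dist (@cnorm R X) f g * normc z <= cnorm (phase_plane f g z).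
Proof.
have [->|z0] := eqVneq z 0; first by rewrite normc0 mulr0 cnorm_ge0.
have n0 : normc z != 0 by apply: contra_neq z0 => /eq0_normc.
have -> : phase_plane f g z = z *: (f - (conjc z / z) *: g).
  by rewrite /phase_plane scalerBr scalerA mulrCA divff// mulr1.
rewrite cnormZ mulrC ler_wpM2l ?normc_ge0//.
apply: (phase_dist_le (@cnorm_ge0 R X)).
rewrite -[`|_|]/((normc _)%:C) normcM normcV normc_conj divff//.
Qed.

(** The pair (f, g) with f - g = u and i (f + g) = v, that is, with
    phase_plane f g taking the values u and v at 1 and i. *)
Definition phase_pair u v : XC * XC :=
  ((2^-1 : R)%:C *: (u - 'i%C *: v), (- (2^-1 : R))%:C *: (u + 'i%C *: v)).

Lemma phase_plane_pair (u v : XC) z :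
  phase_plane (phase_pair u v).1 (phase_pair u v).2 z =
  (complex.Re z)%:C *: u + (complex.Im z)%:C *: v.
Proof.
rewrite /phase_plane /= !scalerA scalerBr scalerDr !scalerA.
rewrite opprD addrACA -scalerBl -opprD -scalerDl -[- (_ *: v)]scaleNr.
by congr (_ *: _ + _ *: _); case: z => a b; apply/eqP; rewrite eq_complex /=;
  apply/andP; split; apply/eqP; field.
Qed.

(** The map w |-> phase_plane f' g' w is z |-> phase_plane f g z composed with
    T w = Re w z1 + Im w z2. The bound on | |f'| - |g'| | follows because T
    maps onto the plane: every f - lam g is, up to a phase, phase_plane f' g' w
    with |w| >= d / sqrt 2, and its modulus is at least |w| | |f'| - |g'| |. *)
Lemma complex_rescaled_pair (E : {pred XC}) f g (eta : R) :
  GRing.submod_closed E -> f \in E -> g \in E ->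
  0 < phase_dist (@cnorm R X) f g -> 0 < eta <= 1 ->
  exists f' g', [/\ f' \in E, g' \in E, cnorm f' + cnorm g' <= 2,
    `|cmodulus f' - cmodulus g'| <=
      Num.sqrt 2 / phase_dist (@cnorm R X) f g * `|cmodulus f - cmodulus g| &
    (1 - eta) / Num.sqrt 2 <= phase_dist (@cnorm R X) f' g'].
Proof.
move=> [E0 EZ] fE gE; set d := phase_dist _ _ _ => d0 eta01.
have EZ' c x : x \in E -> c *: x \in E.
  by move=> xE; rewrite -[_ *: _]addr0; exact: EZ.
have ED x y : x \in E -> y \in E -> x + y \in E.
  by move=> xE yE; rewrite -[x]scale1r; exact: EZ.
have EM z : phase_plane f g z \in E.
  by rewrite /phase_plane -scaleNr ED// EZ'.
have s2 : 0 < Num.sqrt 2 :> R by rewrite sqrtr_gt0.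
have [||z1 [z2 [n1 n2 area0 basis]]] :=
  @near_auerbach R (fun z => cnorm (phase_plane f g z)) d eta d0 eta01.
- by move=> k z; rewrite phase_planeZ cnormZ normc_real.
- exact: cnorm_phase_plane.
pose u := phase_plane f g z1; pose v := phase_plane f g z2.
pose f' := (phase_pair u v).1; pose g' := (phase_pair u v).2.
have planeE z : phase_plane f' g' z =
    phase_plane f g ((complex.Re z)%:C * z1 + (complex.Im z)%:C * z2).
  by rewrite phase_plane_pair phase_plane_lin.
have nz (w : XC) : cnorm w <= 1 -> forall k : R, `|k| = 2^-1 ->
    forall w', cnorm w' <= 1 -> cnorm (k%:C *: (w + w')) <= 1.
  move=> w1 k k2 w' w'1; rewrite cnormZ normc_real k2 ler_pdivrMl// mulr1.
  by apply: (le_trans (cnormD _ _)); exact: lerD.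
have niv : cnorm ('i%C *: v) <= 1 by rewrite cnormZ normci mul1r.
exists f', g'; split.
- by apply: (EZ'); rewrite -scaleNr; apply: (ED); rewrite ?(EZ', EM).
- by apply: (EZ'); apply: (ED); rewrite ?(EZ', EM).
- by rewrite -[2%:R]/(1 + 1) lerD// nz ?cnormN ?normrN ?ger0_norm.
- have key : (d / Num.sqrt 2) *: modulus (cmodulus f' - cmodulus g') <=
      modulus (cmodulus f - cmodulus g).
    apply: cmodulus_phase_inf => lam /unit_phase[z z1' zlam].
    have -> : cmodulus (f - lam *: g) = cmodulus (phase_plane f g z).
      by rewrite (phase_planeE _ _ zlam)// cmodulusZ z1' scale1r.
    pose a := area z z2 / area z1 z2; pose b := area z1 z / area z1 z2.
    have zab : z = a%:C * z1 + b%:C * z2 by exact: area_basis.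
    pose w := Complex a b.
    rewrite (_ : phase_plane f g z = phase_plane f' g' w); last first.
      by rewrite planeE -zab.
    (* 1 = |a z1 + b z2| <= (|a| + |b|) / d <= sqrt 2 |w| / d *)
    have dw : d / Num.sqrt 2 <= normc w.
      rewrite ler_pdivrMr// mulrC; apply: le_trans (Re_Im_sum_le w) => /=.
      have small k y : cnorm (phase_plane f g y) <= 1 ->
          d * normc (k%:C * y) <= `|k|.
        move=> y1; rewrite normcM normc_real mulrCA ler_piMr//.
        exact: le_trans (cnorm_phase_plane f g y) y1.
      rewrite -[leLHS]mulr1 -z1' zab.
      apply: (@le_trans _ _ (d * (normc (a%:C * z1) + normc (b%:C * z2)))).
        by rewrite ler_wpM2l ?(ltW d0)// le_normcD.
      by rewrite mulrDr lerD// small.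
    apply: (le_trans (lev_wpZ2r (modulus_ge0 _) dw)).
    rewrite -modulusZ_ge0 ?normc_ge0// scalerBr -cmodulusZ.
    by rewrite -[in X in _ - X]normc_conj -cmodulusZ cmodulus_dist.
  have dk : 0 < d / Num.sqrt 2 by rewrite divr_gt0.
  rewrite -invf_div ler_pdivlMl// -(norm_modulus (cmodulus f' - _)).
  rewrite -(norm_modulus (cmodulus f - _)) -[X in X * _](gtr0_norm dk) -normrZ.
  apply: le_norm key.
  exact: scalev_ge0 (ltW dk) (modulus_ge0 _).
- apply: le_phase_dist => lam /normc_eq1 /unit_phase[z z1' zlam].
  have -> : cnorm (f' - lam *: g') = cnorm (phase_plane f' g' z).
    by rewrite (phase_planeE _ _ zlam)// cnormZ z1' mul1r.
  rewrite planeE.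
  have [ha hb] := basis (complex.Re z) (complex.Im z).
  have eta1 : 0 <= 1 - eta by case/andP: eta01; rewrite subr_ge0.
  rewrite ler_pdivrMr// mulrC.
  have -> : 1 - eta = normc ((1 - eta)%:C * z).
    by rewrite normcM normc_real z1' mulr1 ger0_norm.
  have ReM : complex.Re ((1 - eta)%:C * z) = (1 - eta) * complex.Re z.
    by case: (z) => x y /=; rewrite mul0r subr0.
  have ImM : complex.Im ((1 - eta)%:C * z) = (1 - eta) * complex.Im z.
    by case: (z) => x y /=; rewrite mul0r addr0.
  by apply: normc_le_max; rewrite ?ReM ?ImM normrM (ger0_norm eta1).
Qed.

End ComplexCase.

Theorem corollary3p12 (R : realType)
    (X : banachLatticeType R) (gam C : R)
    (gam_gt0 : 0 < gam) (gam_le1 : gam <= 1) (C_gt0 : 0 < C) :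
  (forall E : {pred X}, GRing.submod_closed E ->
     holder_SPR Num.norm modulus E gam C ->
     SPR Num.norm modulus E (Num.sqrt 2 * (Num.sqrt 8 * C) `^ gam^-1)) /\
  (forall E : {pred complexification X}, GRing.submod_closed E ->
     holder_SPR cnorm cmodulus E gam C ->
     SPR cnorm cmodulus E (Num.sqrt 2 * (Num.sqrt 8 * C) `^ gam^-1)).
Proof.
have sqrt2_ge1 : 1 <= Num.sqrt 2 :> R.
  by rewrite -[leLHS]sqrtr1 ler_sqrt// ler1n.
split=> E EP hE; apply: holder_SPR_rescaled gam_gt0 gam_le1 C_gt0 hE _.
- exact: normr_ge0.
- move=> f g eta fE gE d0 /andP[eta0 eta1].
  have [f' [g' [f'E g'E n2 md dist]]] := real_rescaled_pair EP fE gE d0.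
  exists f', g'; split=> //.
    apply: le_trans md _; rewrite ler_wpM2r// -[leLHS]mul1r ler_wpM2r//.
    by rewrite invr_ge0 ltW.
  apply: le_trans dist; rewrite ler_pdivrMr ?mul1r ?(lt_le_trans ltr01)//.
  by apply: le_trans sqrt2_ge1; rewrite lerBlDr lerDl ltW.
- exact: cnorm_ge0.
- by move=> f g eta; exact: complex_rescaled_pair.
Qed.
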